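(* Let $c\in\mathbb{R}$ with $c>0$, and let $F_c(x)=x^2+\dfrac{c}{x}$ for real $x\neq 0$. Denote the (distinct) real fixed points of $F_c$, listed from left to right, by $x_1<x_2<\cdots$. Then: (1) When $c>4/27$, there exists only one fixed point $x_1$, and it is repelling. (2) When $c=4/27$, there exist exactly two fixed points $x_1<x_2$; $x_1$ is repelling and $x_2$ is neutral. (3) When $c<4/27$ (that is, $0<c<4/27$), there exist exactly three fixed points $x_1<x_2<x_3$; $x_1$ and $x_3$ are repelling and $x_2$ is attracting.
   Context: A fixed point $x_0$ of a differentiable map $F$ is called attracting if $|F'(x_0)|<1$, repelling if $|F'(x_0)|>1$, and neutral if $|F'(x_0)|=1$. *)

(* Defs.v *)
From HB Require Import structures.
From mathcomp Require Import all_boot all_order all_algebra.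
From mathcomp Require Import all_classical all_reals all_analysis.

Set Implicit Arguments.
Unset Strict Implicit.
Unset Printing Implicit Defensive.

Import Order.TTheory GRing.Theory Num.Theory.
Import numFieldNormedType.Exports.

Local Open Scope classical_set_scope.
Local Open Scope ring_scope.

(* A map F with open domain D is given by a total function of which only the
   values on D are meaningful. Since D is open, the derivative at a point of D
   does not depend on the values outside D. *)
Definition fixed_points (R : realType) (D : set R) (F : R -> R) : set R :=
  [set x | D x /\ F x = x].

Definition attracting (R : realType) (D : set R) (F : R -> R) (x : R) : Prop :=
  [/\ fixed_points D F x, derivable F x 1 & `|derive1 F x| < 1].

Definition repelling (R : realType) (D : set R) (F : R -> R) (x : R) : Prop :=
  [/\ fixed_points D F x, derivable F x 1 & 1 < `|derive1 F x|].

Definition neutral (R : realType) (D : set R) (F : R -> R) (x : R) : Prop :=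
  [/\ fixed_points D F x, derivable F x 1 & `|derive1 F x| = 1].

(* The restriction to x != 0 matters: the convention 0^-1 = 0 would make 0 a
   spurious fixed point of [Fmap c]. *)
Definition Fdom (R : realType) : set R := [set x | x != 0].

Definition Fmap (R : realType) (c : R) (x : R) : R := x ^+ 2 + c / x.

(* Main.v *)
Require Import Defs.
From HB Require Import structures.
From mathcomp Require Import all_boot all_order all_algebra.
From mathcomp Require Import all_classical all_reals all_analysis.
From mathcomp Require Import ring lra.
From mathcomp Require polyrcf.

(** Clearing the denominator turns [Fmap c x = x] into [x ^+ 2 * (1 - x) = c],
    and substituting this relation into the derivative [2 x - c / x ^+ 2] gives
    the multiplier [3 x - 1], with no [c] left. So the type of a fixed point
    depends only on its position: repelling on the negative axis and beyond
    [2/3], attracting on [0 < x < 2/3], neutral at [2/3].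

    It remains to count the solutions of [x ^+ 2 * (1 - x) = c] in each of these
    three zones. The cubic is strictly monotone on each, so a zone contains at
    most one solution; the intermediate value theorem provides one on the
    negative axis for every [c > 0], and one in each of the two other zones
    when [c] is below the local maximum [4/27], attained at [2/3]. When
    [c >= 4/27], the factorization
    [4/27 - x ^+ 2 * (1 - x) = (x - 2/3) ^+ 2 * (x + 1/3)]
    leaves no positive solution besides [2/3], which occurs for [c = 4/27]. *)

Set Implicit Arguments.
Unset Strict Implicit.
Unset Printing Implicit Defensive.

Import Order.TTheory GRing.Theory Num.Theory.
Import numFieldNormedType.Exports.

Local Open Scope classical_set_scope.
Local Open Scope ring_scope.

(** [x = 0] is excluded from the right-hand side because [c] is nonzero. *)
Lemma fixed_points_FmapE (R : realType) (c x : R) : 0 < c ->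
  fixed_points (@Fdom R) (Fmap c) x <-> x ^+ 2 * (1 - x) = c.
Proof.
move=> c_gt0; rewrite /fixed_points /Fdom /Fmap /=; split.
  move=> [x0 Fx].
  have -> : c = c / x * x by rewrite divfK.
  have -> : c / x = x - x ^+ 2 by rewrite -[X in X - _]Fx addrC addKr.
  by ring.
move=> gx; have x0 : x != 0.
  by apply: contraTneq c_gt0 => x0; rewrite -gx x0 expr0n mul0r ltxx.
by split=> //; rewrite -gx; field.
Qed.

Lemma is_derive_Fmap (R : realType) (c x : R) : x != 0 ->
  is_derive x (1 : R) (Fmap c) (2%:R * x - c / x ^+ 2).
Proof.
move=> x0; rewrite /Fmap.
have dV : is_derive x (1 : R) (fun y : R => y^-1) (- x ^- 2 *: (1 : R)).
  exact: is_deriveV.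
have dX : is_derive x (1 : R) (fun y : R => y ^+ 2) (2%:R * x).
  apply: is_derive_eq; rewrite /GRing.scale /=; ring.
have dM : is_derive x (1 : R) (fun y : R => c / y) (c *: (- x ^- 2 *: (1 : R))).
  exact: is_deriveZ.
apply: is_derive_eq.
by rewrite /GRing.scale /= mulr1 mulrN.
Qed.

(** The fixed point equation replaces [c / x ^+ 2] by [1 - x] in the
    derivative. *)
Lemma multiplier_fixed_point (R : realType) (c x : R) : 0 < c ->
  x ^+ 2 * (1 - x) = c ->
  derivable (Fmap c) x 1 /\ derive1 (Fmap c) x = 3%:R * x - 1.
Proof.
move=> c_gt0 gx; have [x0 _] := (fixed_points_FmapE x c_gt0).2 gx.
have dF := is_derive_Fmap c x0; split; first exact: ex_derive.
rewrite derive1E derive_val -gx; field; exact: x0.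
Qed.

Lemma fixed_point_repelling (R : realType) (c x : R) : 0 < c ->
  x ^+ 2 * (1 - x) = c -> (x < 0) || (2%:R / 3%:R < x) ->
  repelling (@Fdom R) (Fmap c) x.
Proof.
move=> c_gt0 gx xzone; have [dF F'] := multiplier_fixed_point c_gt0 gx.
split=> //; first exact/fixed_points_FmapE.
rewrite F' ltr_normr; case/orP: xzone => ?; apply/orP; [right|left]; lra.
Qed.

Lemma fixed_point_attracting (R : realType) (c x : R) : 0 < c ->
  x ^+ 2 * (1 - x) = c -> 0 < x < 2%:R / 3%:R ->
  attracting (@Fdom R) (Fmap c) x.
Proof.
move=> c_gt0 gx /andP[? ?]; have [dF F'] := multiplier_fixed_point c_gt0 gx.
split=> //; first exact/fixed_points_FmapE.
rewrite F' ltr_norml; lra.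
Qed.

Lemma fixed_point_neutral (R : realType) (c x : R) : 0 < c ->
  x ^+ 2 * (1 - x) = c -> x = 2%:R / 3%:R ->
  neutral (@Fdom R) (Fmap c) x.
Proof.
move=> c_gt0 gx x23; have [dF F'] := multiplier_fixed_point c_gt0 gx.
split=> //; first exact/fixed_points_FmapE.
by rewrite F' x23 (_ : _ - 1 = 1) ?normr1 //; field.
Qed.

Section Cubic.
Variable R : realType.
Implicit Types a b c x y : R.

Lemma cubic_ivt c a b : a < b ->
  (a ^+ 2 * (1 - a) - c) * (b ^+ 2 * (1 - b) - c) < 0 ->
  exists2 x, a < x < b & x ^+ 2 * (1 - x) = c.
Proof.
move=> ab sgn; pose p : {poly R} := 'X^2 * (1 - 'X) - c%:P.
have pE x : p.[x] = x ^+ 2 * (1 - x) - c by rewrite /p !hornerE.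
have [|x xab /rootP] := polyrcf.poly_ivtoo (p := p) (ltW ab); first by rewrite !pE.
by rewrite pE => /eqP; rewrite subr_eq0 => /eqP gx; exists x; rewrite -?(itvP xab).
Qed.

(** For distinct [x] and [y], equality of the values forces the divided
    difference [x + y - x ^+ 2 - x * y - y ^+ 2] to vanish. The injectivity on
    each zone comes from its constant sign there. *)
Lemma cubic_divided_difference x y :
  x ^+ 2 * (1 - x) = y ^+ 2 * (1 - y) -> x != y ->
  x + y = x ^+ 2 + x * y + y ^+ 2.
Proof.
move=> gxy; rewrite -subr_eq0 => /mulfI; apply; apply/eqP.
rewrite -subr_eq0; apply/eqP.
have -> : (x - y) * (x + y) - (x - y) * (x ^+ 2 + x * y + y ^+ 2) =
  x ^+ 2 * (1 - x) - y ^+ 2 * (1 - y) by ring.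
by rewrite gxy subrr.
Qed.

Lemma cubic_inj_neg x y : x < 0 -> y < 0 ->
  x ^+ 2 * (1 - x) = y ^+ 2 * (1 - y) -> x = y.
Proof.
move=> x0 y0 gxy; apply/eqP/negPn/negP => /(cubic_divided_difference gxy).
nra.
Qed.

Lemma cubic_inj_middle x y : 0 < x < 2%:R / 3%:R -> 0 < y < 2%:R / 3%:R ->
  x ^+ 2 * (1 - x) = y ^+ 2 * (1 - y) -> x = y.
Proof.
move=> /andP[x0 x1] /andP[y0 y1] gxy.
apply/eqP/negPn/negP => /(cubic_divided_difference gxy).
(* x and y have weights x + y/2 < 1 and y + x/2 < 1 in the right-hand side. *)
have : 0 < x * (1 - x - y / 2%:R) by apply: mulr_gt0 => //; lra.
have : 0 < y * (1 - y - x / 2%:R) by apply: mulr_gt0 => //; lra.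
lra.
Qed.

Lemma cubic_inj_right x y : 2%:R / 3%:R < x -> 2%:R / 3%:R < y ->
  x ^+ 2 * (1 - x) = y ^+ 2 * (1 - y) -> x = y.
Proof.
move=> x1 y1 gxy.
apply/eqP/negPn/negP => /(cubic_divided_difference gxy).
have : 0 < x * (x + y / 2%:R - 1) by apply: mulr_gt0; lra.
have : 0 < y * (y + x / 2%:R - 1) by apply: mulr_gt0; lra.
lra.
Qed.

(** On the negative axis the cubic decreases from [+oo] to [0]. The left
    endpoint [- (1 + c)] is far enough since there the cubic is
    [(1 + c) ^+ 2 * (2 + c) > c]. *)
Lemma cubic_neg_root c : 0 < c -> exists2 x, x < 0 & x ^+ 2 * (1 - x) = c.
Proof.
move=> c0; have [||x /andP[_ x0] gx] := @cubic_ivt c (- (1 + c)) 0.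
- lra.
- rewrite expr0n mul0r sub0r pmulr_rlt0 ?oppr_lt0 //; nra.
- by exists x.
Qed.

(** The critical point [2/3] is a double root of the difference, and the other
    factor is positive for [x >= 0]: hence the maximum [4/27] there. *)
Lemma cubic_max x :
  4%:R / 27%:R - x ^+ 2 * (1 - x) = (x - 2%:R / 3%:R) ^+ 2 * (x + 1 / 3%:R).
Proof. by field. Qed.

End Cubic.

Theorem theorem3p2 (R : realType) (c : R) (c_gt0 : 0 < c) :
  [/\ 4%:R / 27%:R < c ->
        exists x1 : R,
          fixed_points (@Fdom R) (Fmap c) = [set x1] /\
          repelling (@Fdom R) (Fmap c) x1,
      c = 4%:R / 27%:R ->
        exists x1 x2 : R,
          [/\ x1 < x2,
              fixed_points (@Fdom R) (Fmap c) = [set x1; x2],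
              repelling (@Fdom R) (Fmap c) x1 &
              neutral (@Fdom R) (Fmap c) x2] &
      c < 4%:R / 27%:R ->
        exists x1 x2 x3 : R,
          x1 < x2 < x3 /\
          [/\ fixed_points (@Fdom R) (Fmap c) = [set x1; x2; x3],
              repelling (@Fdom R) (Fmap c) x1,
              attracting (@Fdom R) (Fmap c) x2 &
              repelling (@Fdom R) (Fmap c) x3]].
Proof.
have fixE x := fixed_points_FmapE x c_gt0.
have [x1 x1_lt0 gx1] := cubic_neg_root c_gt0.
have rep1 : repelling (@Fdom R) (Fmap c) x1.
  by apply: fixed_point_repelling => //; rewrite x1_lt0.
have g23 : (2%:R / 3%:R) ^+ 2 * (1 - 2%:R / 3%:R) = 4%:R / 27%:R :> R by field.
split=> [c_gt|c_eq|c_lt].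
- exists x1; split=> //; apply/seteqP; split=> x /=; last by move=> ->; apply/fixE.
  move=> /fixE gx; apply: cubic_inj_neg; rewrite ?gx //.
  rewrite ltNge; apply/negP => x_ge0.
  have : 0 <= (x - 2%:R / 3%:R) ^+ 2 * (x + 1 / 3%:R).
    by apply: mulr_ge0; [exact: sqr_ge0 | lra].
  by rewrite -cubic_max gx subr_ge0 leNgt c_gt.
- exists x1, (2%:R / 3%:R); split=> //; first lra.
    apply/seteqP; split=> x /=; last by case=> ->; apply/fixE => //; rewrite g23.
    move=> /fixE gx; have [x_lt0|x_ge0] := ltP x 0.
      by left; apply: cubic_inj_neg; rewrite ?gx.
    have /eqP := cubic_max x; rewrite gx c_eq subrr eq_sym mulf_eq0 sqrf_eq0.
    by rewrite subr_eq0 => /orP[/eqP-> | /eqP ?]; [right | lra].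
  by apply: fixed_point_neutral => //; rewrite g23.
have [||x2 x2_mid gx2] := @cubic_ivt _ c 0 (2%:R / 3%:R); first lra.
  rewrite g23 expr0n mul0r sub0r; nra.
have [||x3 /andP[x3_gt _] gx3] := @cubic_ivt _ c (2%:R / 3%:R) 1; first lra.
  rewrite g23 subrr mulr0 sub0r; nra.
exists x1, x2, x3; split; first by case/andP: x2_mid => *; apply/andP; split; lra.
split=> //; last 2 first.
- exact: fixed_point_attracting.
- by apply: fixed_point_repelling => //; rewrite x3_gt orbT.
apply/seteqP; split=> x /=; last by case=> [[]|] ->; apply/fixE.
move=> gxF; have [x_neq0 _] := gxF; move/fixE: gxF => gx.
have [x_lt0|x_gt0|x0] := ltgtP x 0; last by rewrite /Fdom /= x0 eqxx in x_neq0.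
  by left; left; apply: cubic_inj_neg; rewrite ?gx.
have [x_lt|x_gt|x23] := ltgtP x (2%:R / 3%:R).
- by left; right; apply: cubic_inj_middle; rewrite ?gx // x_gt0 x_lt.
- by right; apply: cubic_inj_right; rewrite ?gx.
by move: c_lt; rewrite -gx x23 g23 ltxx.
Qed.
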